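(* Let $d\ge 1$. For every discrete set of centers $\Xi\subseteq\mathbb{R}^d$ and every appetite $\alpha\in[0,\infty]$, there exists a stable allocation of $\mathbb{R}^d$ to $\Xi$ with appetite $\alpha$.
   Context: $|\cdot|$ is the Euclidean norm and $\mathcal{L}$ is Lebesgue measure (volume) on $\mathbb{R}^d$. Elements of $\mathbb{R}^d$ are called sites. A set $\Xi\subset\mathbb{R}^d$ is discrete if every bounded subset of $\mathbb{R}^d$ contains only finitely many of its elements; elements of $\Xi$ are called centers. An allocation of $\mathbb{R}^d$ to $\Xi$ with appetite $\alpha\in[0,\infty]$ is a measurable function $\psi:\mathbb{R}^d\to\Xi\cup\{\infty,\Delta\}$ (where $\infty,\Delta$ are two extra symbols) such that $\mathcal{L}[\psi^{-1}(\Delta)]=0$ and $\mathcal{L}[\psi^{-1}(\xi)]\le\alpha$ for all $\xi\in\Xi$. The set $\psi^{-1}(\xi)$ is the territory of $\xi$. A center $\xi$ is sated if $\mathcal{L}[\psi^{-1}(\xi)]=\alpha$ and unsated otherwise. A site $x$ is claimed if $\psi(x)\in\Xi$ and unclaimed if $\psi(x)=\infty$. Stability: let $\xi$ be a center and $x$ a site with $\psi(x)\notin\{\xi,\Delta\}$. We say $x$ desires $\xi$ if $|x-\xi|<|x-\psi(x)|$ or $x$ is unclaimed. We say $\xi$ covets $x$ if $|x-\xi|<|x'-\xi|$ for some $x'\in\psi^{-1}(\xi)$, or $\xi$ is unsated. The pair $(x,\xi)$ is unstable for $\psi$ if $x$ desires $\xi$ and $\xi$ covets $x$. An allocation is stable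 if there are no unstable pairs. *)

(* Defs.v *)
From HB Require Import structures.
From mathcomp Require Import all_boot all_order all_algebra.
From mathcomp Require Import all_classical all_reals all_analysis.

Set Implicit Arguments.
Unset Strict Implicit.
Unset Printing Implicit Defensive.

Import Order.TTheory GRing.Theory Num.Theory.
Import numFieldNormedType.Exports.

Local Open Scope classical_set_scope.
Local Open Scope ring_scope.

(* R^d is [d.-tuple R]; its measurable sets are those of the product
   sigma-algebra, i.e. the Borel sets. *)

Section Euclidean.
Context {R : realType} {d : nat}.
Implicit Types (x y : d.-tuple R) (B Xi : set (d.-tuple R)).

Definition enorm x : R := Num.sqrt (\sum_(i < d) tnth x i ^+ 2).

Definition edist x y : R := enorm [tuple tnth x i - tnth y i | i < d].

Definition ebounded B := exists M : R, forall x, B x -> enorm x <= M.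

Definition discrete_centers Xi :=
  forall B, ebounded B -> finite_set (Xi `&` B).

End Euclidean.

Lemma sigma_finite_pushforward_product (R : realType) d1 d2 d3
    (T1 : measurableType d1) (T2 : measurableType d2) (T3 : measurableType d3)
    (m1 : {sigma_finite_measure set T1 -> \bar R})
    (m2 : {sigma_finite_measure set T2 -> \bar R})
    (f : T1 * T2 -> T3) (g : T3 -> T1 * T2) :
  measurable_fun [set: T1 * T2] f -> measurable_fun [set: T3] g ->
  cancel f g ->
  exists m : {sigma_finite_measure set T3 -> \bar R},
    pushforward (m1 \x m2)%E f = m :> (set T3 -> \bar R).
Proof.
move=> mf mg fK.
pose p := [the {measure set _ -> \bar R} of (m1 \x m2)%E].
pose mu : set T3 -> \bar R := pushforward p f.
have mu0 : mu set0 = 0%E by rewrite /mu /pushforward preimage_set0 measure0.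
have mu_ge0 A : (0 <= mu A)%E by exact: measure_ge0.
have mu_sigma : semi_sigma_additive mu.
  exact: (@measure_semi_sigma_additive _ _ _
    (measure_function_pushforward__canonical__measure_function_Measure p mf)).
have mu_sf : sigma_finite [set: T3] mu.
  have /sigma_finiteP[F [FT ndF Ffin]] := sigma_finiteT m1.
  have /sigma_finiteP[G [GT ndG Gfin]] := sigma_finiteT m2.
  exists (fun k => g @^-1` (F k `*` G k)).
    rewrite -preimage_bigcup (_ : \bigcup_k _ = [set: T1 * T2])//.
    apply/seteqP; split => // -[x y] _.
    have [k _ Fx] : (\bigcup_k F k) x by rewrite -FT.
    have [l _ Gy] : (\bigcup_k G k) y by rewrite -GT.
    exists (maxn k l) => //; split => /=.
    - by move: x Fx; apply/subsetPset/ndF/leq_maxl.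
    - by move: y Gy; apply/subsetPset/ndG/leq_maxr.
  move=> k; have [mF Foo] := Ffin k; have [mG Goo] := Gfin k; split.
    by rewrite -[X in measurable X]setTI; apply: mg => //; exact: measurableX.
  rewrite /mu /pushforward -comp_preimage.
  rewrite (_ : g \o f = id); last exact/funext.
  by rewrite /p /= product_measure1E// lte_mul_pinfty// ge0_fin_numE.
rewrite -[pushforward _ _]/mu.
move: mu mu0 mu_ge0 mu_sigma mu_sf => mu mu0 mu_ge0 mu_sigma mu_sf.
pose M1 := isMeasure.Build _ _ _ mu mu0 mu_ge0 mu_sigma.
pose M : {measure set T3 -> \bar R} := HB.pack mu M1.
pose M2 := Measure_isSigmaFinite.Build _ _ _ M mu_sf.
pose S : {sigma_finite_measure set T3 -> \bar R} :=
  HB.pack (Measure.sort M) M2.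
by exists S.
Qed.

Section LebesgueVolume.
Context {R : realType}.

Definition tuple_cons n (p : measurableTypeR R * n.-tuple R) : n.+1.-tuple R :=
  [tuple of p.1 :: p.2].

Lemma measurable_tuple_cons n : measurable_fun [set: _] (@tuple_cons n).
Proof.
by apply: measurable_cons => //; exact: (@measurable_fst _ _ (measurableTypeR R)).
Qed.

(* The d-fold product of one-dimensional Lebesgue measure, carried from
   R * R^n to R^n.+1; R^0 is a point of mass 1. *)
Fixpoint volume n : set (n.-tuple R) -> \bar R :=
  match n with
  | 0 => \d_([tuple] : 0.-tuple R)
  | n'.+1 =>
      pushforward (lebesgue_measure \x @volume n')%E (@tuple_cons n')
  end.


Let volume_spec n :
  exists m : {sigma_finite_measure set (n.-tuple R) -> \bar R},
    @volume n = m :> (set _ -> \bar R).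
Proof.
elim: n => [|n [m volm]]; first by exists (\d_([tuple] : 0.-tuple R)).
pose f (t : n.+1.-tuple R) : measurableTypeR R * n.-tuple R :=
  (thead t, [tuple of behead t]).
rewrite /= volm.
apply: (@sigma_finite_pushforward_product _ _ _ _ _ _ _ _ _ _ f).
- exact: measurable_tuple_cons.
- apply/measurable_fun_pairP; split; last exact: measurable_behead.
  exact: measurable_tnth.
- by case=> x t; rewrite /f /tuple_cons theadE; congr pair; exact: val_inj.
Qed.

Let volume0 n : @volume n set0 = 0%E.
Proof. by have [m ->] := volume_spec n; rewrite measure0. Qed.

Let volume_ge0 n A : (0 <= @volume n A)%E.
Proof. by have [m ->] := volume_spec n; exact: measure_ge0. Qed.

Let volume_sigma_additive n : semi_sigma_additive (@volume n).
Proof.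
by have [m ->] := volume_spec n; exact: measure_semi_sigma_additive.
Qed.

HB.instance Definition _ n := isMeasure.Build _ _ _ (@volume n)
  (@volume0 n) (@volume_ge0 n) (@volume_sigma_additive n).

Let volume_sigma_finite n : sigma_finite [set: _] (@volume n).
Proof. by have [m ->] := volume_spec n; exact: sigma_finiteT. Qed.

HB.instance Definition _ n := Measure_isSigmaFinite.Build _ _ _ (@volume n)
  (@volume_sigma_finite n).

Lemma volume_box n (A : 'I_n -> set R) : (forall i, measurable (A i)) ->
  volume [set t : n.-tuple R | forall i, A i (tnth t i)] =
  (\prod_(i < n) lebesgue_measure (A i))%E.
Proof.
elim: n A => [|n IHn] A mA.
  by rewrite big_ord0 /= diracE mem_set// => -[].
rewrite big_ord_recl -IHn//= -product_measure1E//.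
  congr product_measure1; apply/seteqP; split => -[x t] /=.
    move=> At; split=> [|i]; first by have := At ord0; rewrite tnth0.
    by have := At (lift ord0 i); rewrite tnthS.
  by move=> [Ax At] i; case: (unliftP ord0 i) => [j|] ->; rewrite ?tnthS ?tnth0.
  exact: (mA ord0).
rewrite (_ : [set _ | _] = \bigcap_(i in [set: 'I_n])
    [set t : n.-tuple R | A (lift ord0 i) (tnth t i)]); last first.
  by apply/seteqP; split => t At => [i _|i]; [exact: At|exact: (At i I)].
apply: fin_bigcap_measurable => // i _.
by rewrite -[X in measurable X]setTI; exact: measurable_tnth.
Qed.

End LebesgueVolume.

(* The elements of Xi together with the two extra symbols: [Infinity] for
   the unclaimed sites and [Delta] for the exceptional null set.  Every
   subset is measurable; in the intended use Xi is countable. *)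
Inductive alloc_value (T : Type) (Xi : set T) : Type :=
  | Center of Xi
  | Infinity
  | Delta.

Arguments Center {T Xi} _.
Arguments Infinity {T Xi}.
Arguments Delta {T Xi}.

Section AllocValue.
Context {T : Type} {Xi : set T}.

HB.instance Definition _ := gen_eqMixin (alloc_value Xi).
HB.instance Definition _ := gen_choiceMixin (alloc_value Xi).
HB.instance Definition _ := isPointed.Build (alloc_value Xi) Infinity.
HB.instance Definition _ := @isMeasurable.Build default_measure_display
  (alloc_value Xi) discrete_measurable discrete_measurable0
  discrete_measurableC discrete_measurableU.

End AllocValue.

Section Allocation.
Context {R : realType} {d : nat} {Xi : set (d.-tuple R)}.
Variables (alpha : \bar R) (psi : d.-tuple R -> alloc_value Xi).
Implicit Types (x : d.-tuple R) (xi : Xi).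

Definition territory xi : set (d.-tuple R) := psi @^-1` [set Center xi].

Definition is_allocation :=
  [/\ measurable_fun [set: d.-tuple R] psi,
      volume (psi @^-1` [set Delta]) = 0%E
    & forall xi, (volume (territory xi) <= alpha)%E].

Definition sated xi := volume (territory xi) = alpha.

Definition unclaimed x := psi x = Infinity.

Definition desires x xi :=
  (exists2 eta : Xi, psi x = Center eta
     & edist x (\val xi) < edist x (\val eta)) \/ unclaimed x.

Definition covets xi x :=
  (exists2 x', territory xi x' & edist x (\val xi) < edist x' (\val xi))
  \/ ~ sated xi.

(* [desires] and [covets] are only meant for pairs satisfying the first two
   clauses. *)
Definition unstable x xi :=
  [/\ psi x <> Center xi, psi x <> Delta, desires x xi & covets xi x].

Definition stable_allocation :=
  is_allocation /\ forall x xi, ~ unstable x xi.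

End Allocation.

(* Main.v *)
Require Import Defs.
From mathcomp Require Import all_boot all_order all_algebra.
From mathcomp Require Import all_classical all_reals all_analysis.
From mathcomp Require Import measurable_realfun ring lra.

(* Give every center xi a radius r xi in [-oo, +oo] and let a site accept the
   centers whose balls contain it and choose the nearest accepted one.  The
   radii are updated by letting xi keep the largest ball in which the volume
   of the sites that prefer xi to all the centers they accept is at most the
   appetite.  Shrinking radii reduces the competition, so this update is
   monotone and has a fixed point by Knaster-Tarski.  At a fixed point an
   unsated center has infinite radius, because spheres are null sets; so a
   center desired by a site that it does not own is sated and lies at more
   than its radius from the site, whence it does not covet it. *)

Set Implicit Arguments.
Unset Strict Implicit.
Unset Printing Implicit Defensive.

Import Order.TTheory GRing.Theory Num.Theory.
Import numFieldNormedType.Exports.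

Local Open Scope classical_set_scope.
Local Open Scope ring_scope.

(* [edist] alone would denote the extended distance of MathComp-Analysis. *)
Local Notation edist := Defs.edist.

(** * Fixed points of monotone maps, and tools from measure theory *)

Lemma ereal_fun_fixpoint (R : realType) (I : Type)
    (F : (I -> \bar R) -> I -> \bar R) :
  (forall r s, (forall i, r i <= s i)%E -> forall i, (F r i <= F s i)%E) ->
  exists r, forall i, F r i = r i.
Proof.
move=> Fmono; pose P := [set r | forall i, (r i <= F r i)%E].
(* Knaster-Tarski: the pointwise supremum of the post-fixed points is itself post-fixed, and
   applying [F] to it gives another member of [P]. *)
pose r0 i := ereal_sup [set r i | r in P].
have r0F i : (r0 i <= F r0 i)%E.
  apply: ge_ereal_sup => _ [r Pr <-]; apply: le_trans (Pr i) _.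
  by apply: Fmono => j; apply: ereal_sup_ubound; exists r.
exists r0 => i; apply/le_anti; rewrite r0F andbT.
by apply: ereal_sup_ubound; exists (F r0) => //; exact: Fmono.
Qed.

(** The function [g] is monotone, at most [alpha] below [s0] and at least [alpha] above it.
    Continuity of [mu] from below and from above, together with the nullity of the level sets of
    [f], transfers both bounds to [s0] itself. *)
Lemma saturating_level d (T : measurableType d) (R : realType)
    (mu : {measure set T -> \bar R}) (A : set T) (f : T -> R) (alpha : \bar R)
    (g := fun s => mu (A `&` [set x | ((f x)%:E <= s)%E]))
    (s0 := ereal_sup [set s | (g s <= alpha)%E]) :
  measurable A -> measurable_fun setT f -> (forall x, 0 <= f x) ->
  (forall r : R, mu [set x | f x = r] = 0%E) ->
  (forall r : R, (mu [set x | (f x <= r)%R] < +oo)%E) -> (0 <= alpha)%E ->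
  (g s0 <= alpha)%E /\ ((s0 < +oo)%E -> g s0 = alpha).
Proof.
move=> mA mf f0 mu0 mufin alpha0.
have mle s : measurable [set x | ((f x)%:E <= s)%E].
  by rewrite -[X in measurable X]setTI; apply: measurable_lee => //;
    exact/measurable_EFinP.
have mAle s : measurable (A `&` [set x | ((f x)%:E <= s)%E]).
  exact: measurableI.
have gmono s t : (s <= t)%E -> (g s <= g t)%E.
  move=> st; apply: le_measure; rewrite ?inE//.
  by move=> x [Ax] /= fs; split=> //=; exact: le_trans st.
have gle s : (s < s0)%E -> (g s <= alpha)%E.
  by move=> /ereal_sup_gt[t gt /ltW st]; exact: le_trans (gmono _ _ st) gt.
have gge s : (s0 < s)%E -> (alpha <= g s)%E.
  move=> s0s; rewrite leNgt; apply/negP => /ltW gs.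
  by move: s0s; apply/negP; rewrite -leNgt; exact: ereal_sup_ubound.
(* The sublevel set at -1 is empty as [f] is nonnegative; this excludes [s0 = -oo], where [g]
   vanishes and could not equal a positive [alpha]. *)
have s0_ge : (-1%:E <= s0)%E.
  apply: ereal_sup_ubound => /=; rewrite /g (_ : _ `&` _ = set0) ?measure0//.
  apply/seteqP; split => // x [_] /=; rewrite lee_fin => fx.
  by have := le_trans (f0 x) fx; rewrite ler0N1.
have ltDinv (r : R) n : r < r + n.+1%:R^-1 by rewrite ltrDl invr_gt0.
have ltBinv (r : R) n : r - n.+1%:R^-1 < r by rewrite ltrBlDr.
move: gle gge s0_ge; case: s0 => [r| |] gle gge s0_ge.
- suff [gr1 gr2] : (g r%:E <= alpha)%E /\ (alpha <= g r%:E)%E.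
    by split=> // _; apply/le_anti; rewrite gr1.
  split.
    have mlt : measurable (A `&` [set x | f x < r]).
      apply: measurableI => //; rewrite -[X in measurable X]setTI.
      rewrite (_ : [set x | _] = [set x | ((f x)%:E < r%:E)%E])//.
      by apply: measurable_lte => //; exact/measurable_EFinP.
    have meq : measurable [set x | f x = r].
      by rewrite -[X in measurable X]setTI; exact: (mf measurableT [set r]).
    (* Levels below [r] exhaust only the strict sublevel set; the remaining part of [f x = r] is
       null. *)
    have -> : g r%:E = mu (A `&` [set x | f x < r]).
      rewrite /g (_ : _ `&` _ = (A `&` [set x | f x < r])
          `|` (A `&` [set x | f x = r])).
        apply: measureU0 => //; first exact: measurableI.
        apply: (subset_measure0 _ meq _ (mu0 r)); first exact: measurableI.
        exact: subIsetr.
      rewrite -setIUr; congr setI; apply/seteqP; split=> x /=.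
        by rewrite lee_fin le_eqVlt => /orP[/eqP|]; [right|left].
      by rewrite lee_fin => -[/ltW|->].
    pose B n := A `&` [set x | ((f x)%:E <= (r - n.+1%:R^-1)%:E)%E].
    have -> : A `&` [set x | f x < r] = \bigcup_n B n.
      rewrite /B -setI_bigcupr; congr setI; apply/seteqP; split=> x /=.
        move=> /ltr_add_invr[n fn]; by exists n => //=; rewrite lee_fin lerBrDr ltW.
      move=> [n _] /=; rewrite lee_fin => /le_lt_trans; exact.
    have cB : mu \o B @ \oo --> mu (\bigcup_n B n).
      apply: nondecreasing_cvg_mu.
      + by move=> n; exact: mAle.
      + by apply: bigcupT_measurable => n; exact: mAle.
      + move=> m n mn; apply/subsetPset => x [Ax] /=; rewrite lee_fin => fx.
        split=> //=; rewrite lee_fin; apply: le_trans fx _.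
        by rewrite lerB// lef_pV2 ?posrE// ler_nat.
    rewrite -(cvg_lim _ cB)//; apply: lime_le; first exact: cvgP cB.
    by apply: nearW => n /=; apply: gle; rewrite lte_fin.
  pose B n := A `&` [set x | ((f x)%:E <= (r + n.+1%:R^-1)%:E)%E].
  have -> : g r%:E = mu (\bigcap_n B n).
    rewrite /g; congr (mu _); apply/seteqP; split=> x /=.
      move=> [Ax]; rewrite lee_fin => fx n _; split=> //=; rewrite lee_fin.
      by apply: le_trans fx _; exact/ltW.
    move=> Bx; split; first by have [] := Bx 0%N I.
    rewrite lee_fin leNgt; apply/negP => /ltr_add_invr[n fn].
    by have [_ /=] := Bx n I; rewrite lee_fin leNgt => /negP[].
  (* Continuity from above needs a set of finite measure in the sequence; [B 0] is one by
     [mufin]. *)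
  have cB : mu \o B @ \oo --> mu (\bigcap_n B n).
    apply: nonincreasing_cvg_mu.
    + apply: le_lt_trans (mufin (r + 1%:R^-1)).
      apply: le_measure; rewrite ?inE; [exact: mAle| |exact: subIsetr].
      exact: (mle (r + 1%:R^-1)%:E).
    + by move=> n; exact: mAle.
    + by apply: bigcapT_measurable => n; exact: mAle.
    + move=> m n mn; apply/subsetPset => x [Ax] /=; rewrite lee_fin => fx.
      split=> //=; rewrite lee_fin; apply: le_trans fx _.
      by rewrite lerD2l lef_pV2 ?posrE// ler_nat.
  rewrite -(cvg_lim _ cB)//; apply: lime_ge; first exact: cvgP cB.
  by apply: nearW => n /=; apply: gge; rewrite lte_fin.
- split; last by rewrite ltxx.
  pose B n := A `&` [set x | ((f x)%:E <= n%:R%:E)%E].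
  have -> : g +oo%E = mu (\bigcup_n B n).
    rewrite /g /B -setI_bigcupr; congr (mu (_ `&` _)).
    apply/seteqP; split=> x /= _; last by rewrite leey.
    by exists (Num.bound (f x)) => //=; rewrite lee_fin ltW// archi_boundP.
  have cB : mu \o B @ \oo --> mu (\bigcup_n B n).
    apply: nondecreasing_cvg_mu.
    + by move=> n; exact: mAle.
    + by apply: bigcupT_measurable => n; exact: mAle.
    + move=> m n mn; apply/subsetPset => x [Ax] /=; rewrite lee_fin => fx.
      by split=> //=; rewrite lee_fin; apply: le_trans fx _; rewrite ler_nat.
  rewrite -(cvg_lim _ cB)//; apply: lime_le; first exact: cvgP cB.
  by apply: nearW => n /=; apply: gle; rewrite ltry.
- by [].
Qed.

(** Tonelli: by uniqueness of the product measure, [X] may be measured by integrating its sections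
    in the other order. *)
Lemma product_measure_null_ysections d1 d2 (T1 : measurableType d1)
    (T2 : measurableType d2) (R : realType)
    (m1 : {sigma_finite_measure set T1 -> \bar R})
    (m2 : {sigma_finite_measure set T2 -> \bar R}) (X : set (T1 * T2)) :
  measurable X -> (forall y, m1 (ysection X y) = 0%E) -> (m1 \x m2)%E X = 0%E.
Proof.
move=> mX X0; rewrite (@product_measure_unique _ _ _ _ _ _ _ (m1 \x^ m2)%E)//.
  by rewrite /product_measure2; apply: integral0_eq => y _ /=; exact: X0.
by move=> A B mA mB; exact: product_measure2E.
Qed.

(** * Distance, spheres, balls and discrete sets in Euclidean space *)

Section EuclideanGeometry.
Context {R : realType}.

Lemma edistE n (x y : n.-tuple R) :
  edist x y = Num.sqrt (\sum_(i < n) (tnth x i - tnth y i) ^+ 2).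
Proof. by congr Num.sqrt; apply: eq_bigr => i _; rewrite tnth_mktuple. Qed.

Lemma edist_ge0 n (x y : n.-tuple R) : 0 <= edist x y.
Proof. exact: sqrtr_ge0. Qed.

Lemma measurable_edist n (y : n.-tuple R) :
  measurable_fun [set: n.-tuple R] (edist ^~ y).
Proof.
rewrite (_ : edist ^~ y = Num.sqrt \o
    (fun x => \sum_(i < n) (tnth x i - tnth y i) ^+ 2)); last first.
  by apply/funext => x; rewrite edistE.
apply: measurableT_comp.
  by apply: continuous_measurable_fun; exact: sqrt_continuous.
apply: measurable_sum => i; apply: measurable_funX.
by apply: measurable_funB => //; exact: measurable_tnth.
Qed.

Lemma ler_coord_edist n (x y : n.-tuple R) i :
  `|tnth x i - tnth y i| <= edist x y.
Proof.
rewrite edistE -sqrtr_sqr ler_wsqrtr// (bigD1 i)//= lerDl.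
by apply: sumr_ge0 => j _; exact: sqr_ge0.
Qed.

(** Stands in for the triangle inequality when bounding balls; it comes from the coordinatewise
    identity $2((a-b)^2+a^2)-b^2=(2a-b)^2$. *)
Lemma enorm_le_edist n (x y : n.-tuple R) :
  enorm y <= Num.sqrt ((edist x y ^+ 2 + enorm x ^+ 2) *+ 2).
Proof.
have sge0 (F : 'I_n -> R) : 0 <= \sum_(i < n) F i ^+ 2.
  by apply: sumr_ge0 => j _; exact: sqr_ge0.
rewrite edistE /enorm !sqr_sqrtr// ler_wsqrtr// -big_split /= -sumrMnl.
apply: ler_sum => i _; set a := tnth x i; set b := tnth y i.
rewrite -subr_ge0 (_ : _ - _ = (2 * a - b) ^+ 2); first exact: sqr_ge0.
by ring.
Qed.

(** Once all coordinates but the first are fixed, at most two points of the sphere remain. In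
    dimension 0 the sphere of radius 0 has mass 1. *)
Lemma volume_sphere n (y : n.-tuple R) (r : R) : (0 < n)%N ->
  volume [set x | edist x y = r] = 0%E.
Proof.
case: n y => // n y _.
have mS : measurable [set x | edist x y = r].
  rewrite -[X in measurable X]setTI.
  exact: (measurable_edist y measurableT (measurable_set1 r)).
rewrite -[LHS]/((lebesgue_measure \x @volume R n)%E
  (@tuple_cons R n @^-1` [set x | edist x y = r])).
apply: product_measure_null_ysections => [|t].
  by rewrite -[X in measurable X]setTI; exact: measurable_tuple_cons.
apply: countable_lebesgue_measure0; apply: finite_set_countable.
pose c := \sum_(i < n) (tnth t i - tnth y (lift ord0 i)) ^+ 2.
(* If [r ^+ 2 < c], the root defaults to 0, which is harmless: the section is then empty and only an
   inclusion is required. *)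
pose s := Num.sqrt (r ^+ 2 - c).
apply: (@sub_finite_set _ _ [set tnth y ord0 + s; tnth y ord0 - s]); last first.
  exact: finite_set2.
move=> a; rewrite /ysection /= inE /= edistE big_ord_recl /= => ra.
have aE : (a - tnth y ord0) ^+ 2 = r ^+ 2 - c.
  rewrite -ra sqr_sqrtr; last first.
    by rewrite addr_ge0 ?sqr_ge0// sumr_ge0// => i _; exact: sqr_ge0.
  rewrite tnth0 /c (eq_bigr (fun i => (tnth t i - tnth y (lift ord0 i)) ^+ 2)).
    by rewrite addrK.
  by move=> i _; rewrite tnthS.
have : `|a - tnth y ord0| = s by rewrite /s -aE sqrtr_sqr.
by case: (ger0P (a - tnth y ord0)) => _ <-; [left|right]; rewrite /=; ring.
Qed.

Lemma volume_ball_fin n (y : n.-tuple R) (r : R) :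
  (volume [set x | (edist x y <= r)%R] < +oo)%E.
Proof.
pose A (i : 'I_n) := `[tnth y i - r, tnth y i + r]%classic.
have mA i : measurable (A i) by exact: measurable_itv.
apply: (@le_lt_trans _ _ (volume [set t : n.-tuple R | forall i, A i (tnth t i)])).
  apply: le_measure; rewrite ?inE.
  - rewrite -[X in measurable X]setTI; apply: measurable_fun_le => //.
    exact: measurable_edist.
  - rewrite (_ : [set _ | _] = \bigcap_(i in [set: 'I_n])
        [set t : n.-tuple R | A i (tnth t i)]); last first.
      by apply/seteqP; split => t At => [i _|i]; [exact: At|exact: (At i I)].
    apply: fin_bigcap_measurable => // i _.
    by rewrite -[X in measurable X]setTI; exact: measurable_tnth.
  - move=> x /= xr i; rewrite /A /= in_itv /=.
    have := le_trans (ler_coord_edist x y i) xr.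
    by rewrite ler_norml => /andP[]; lra.
rewrite volume_box// ltey_eq prode_fin_num// => i _.
by rewrite /A lebesgue_measure_itv /=; case: ifP.
Qed.

Lemma finite_centers_edist n (Xi : set (n.-tuple R)) (x : n.-tuple R) (r : R) :
  discrete_centers Xi -> finite_set [set xi : Xi | edist x (\val xi) <= r].
Proof.
move=> dXi.
have : finite_set (Xi `&` [set y | edist x y <= r]).
  apply: dXi; exists (Num.sqrt ((r ^+ 2 + enorm x ^+ 2) *+ 2)) => y /= xy.
  apply: le_trans (enorm_le_edist x y) _.
  rewrite ler_wsqrtr// lerMn2r lerD2r ler_sqr//= ?nnegrE ?edist_ge0//.
  exact: le_trans (edist_ge0 _ _) xy.
move=> fin.
have -> : [set xi : Xi | edist x (\val xi) <= r] =
  val @^-1` (Xi `&` [set y | edist x y <= r]).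
  apply/seteqP; split=> xi /=; last by case.
  by move=> ?; split=> //; exact: set_valP.
apply: finite_preimage => //.
by move=> ? ? _ _; exact: val_inj.
Qed.

Lemma discrete_centers_countable n (Xi : set (n.-tuple R)) :
  discrete_centers Xi -> countable Xi.
Proof.
move=> dXi; rewrite (_ : Xi = \bigcup_k (Xi `&` [set y | enorm y <= k%:R])).
  apply: bigcup_countable => // k _; apply: finite_set_countable; apply: dXi.
  by exists k%:R.
rewrite -setI_bigcupr; apply/seteqP; split=> y; last by case.
move=> Xy; split=> //; exists (Num.bound (enorm y)) => //=.
by rewrite ltW// archi_boundP// sqrtr_ge0.
Qed.

End EuclideanGeometry.

(** * Preferences of the sites and the monotone update of the radii *)

Lemma seq_minimum (T : eqType) (le : rel T) (s : seq T) :
  total le -> transitive le -> s != [::] ->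
  exists2 m, m \in s & {in s, forall x, le m x}.
Proof.
move=> le_total le_trans.
have := sort_sorted le_total s; have := mem_sort le s.
case: (sort le s) => [s0|m t mE] sle.
  by case: s s0 {sle} => // x s /(_ x); rewrite mem_head.
move=> _; exists m; first by rewrite -mE mem_head.
move=> x; rewrite -mE inE => /predU1P[->|].
  by have := le_total m m; rewrite orbb.
by move=> xt; have /allP := order_path_min le_trans sle; exact.
Qed.

Section RadiiFixpoint.
Context {R : realType} {d : nat} {Xi : set (d.-tuple R)} (alpha : \bar R).
Hypotheses (d_gt0 : (0 < d)%N) (hXi : discrete_centers Xi).
Hypothesis (alpha_ge0 : (0 <= alpha)%E).
Variable (idx : Xi -> nat).
Hypothesis idx_inj : injective idx.
Implicit Types (x : d.-tuple R) (xi eta : Xi) (r : Xi -> \bar R).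

(* Breaking ties by [idx] makes the exceptional null set empty. *)
Definition prefers x xi eta :=
  (edist x (\val xi) < edist x (\val eta)) ||
  ((edist x (\val xi) == edist x (\val eta)) && (idx xi <= idx eta)%N).

Lemma prefers_total x : total (prefers x).
Proof.
move=> xi eta; rewrite /prefers.
by case: ltgtP => //= _; rewrite leq_total.
Qed.

Lemma prefers_trans x : transitive (prefers x).
Proof.
move=> eta xi zeta /orP[lt1|/andP[/eqP e1 i1]] /orP[lt2|/andP[/eqP e2 i2]];
  rewrite /prefers.
- by rewrite (lt_trans lt1 lt2).
- by rewrite -e2 lt1.
- by rewrite e1 lt2.
- by rewrite e1 e2 eqxx (leq_trans i1 i2) orbT.
Qed.

Lemma prefers_anti x : antisymmetric (prefers x).
Proof.
move=> xi eta; rewrite /prefers; case: ltgtP => //= _.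
by move=> /anti_leq; exact: idx_inj.
Qed.

Lemma prefers_edist x xi eta :
  prefers x xi eta -> edist x (\val xi) <= edist x (\val eta).
Proof. by case/orP => [/ltW//|/andP[/eqP->]]. Qed.

Definition accepts r x xi := ((edist x (\val xi))%:E <= r xi)%E.

(** The site need not accept [xi]: the condition at [eta = xi] is trivial, so only the radii of the
    other centers matter. *)
Definition applicants r xi : set (d.-tuple R) :=
  [set x | forall eta, accepts r x eta -> prefers x xi eta].

(** The value [+oo] describes a center that rejects no site. *)
Definition rejection_radius r xi : \bar R :=
  ereal_sup [set s | (volume (applicants r xi `&`
    [set x | ((edist x (\val xi))%:E <= s)%E]) <= alpha)%E].

Let countable_centers : countable [set: Xi].
Proof.
have /countable_injP[f f_inj] := discrete_centers_countable hXi.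
apply/countable_injP; exists (f \o \val) => xi eta _ _ /f_inj.
by rewrite !inE => /(_ (set_valP xi) (set_valP eta)); exact: val_inj.
Qed.

Lemma measurable_accepts r xi : measurable [set x | accepts r x xi].
Proof.
rewrite -[X in measurable X]setTI; apply: measurable_lee => //.
by apply/measurable_EFinP; exact: measurable_edist.
Qed.

Lemma measurable_prefers xi eta : measurable [set x | prefers x xi eta].
Proof.
have mdist zeta := measurable_edist (\val zeta : d.-tuple R).
have mp : measurable_fun setT (fun x => prefers x xi eta).
  apply: measurable_or; first exact: measurable_fun_ltr.
  by apply: measurable_and => //; exact: measurable_fun_eqr.
rewrite (_ : [set _ | _] = setT `&` (fun x => prefers x xi eta) @^-1` [set true]).
  exact: mp.
by rewrite setTI.
Qed.

Lemma measurable_applicants r xi : measurable (applicants r xi).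
Proof.
rewrite (_ : applicants r xi = ~` \bigcup_eta
    ([set x | accepts r x eta] `\` [set x | prefers x xi eta])).
  apply: measurableC; apply: countable_bigcupT_measurable => // eta.
  apply: measurableD; [exact: measurable_accepts|exact: measurable_prefers].
rewrite setC_bigcup; apply/seteqP; split=> x /= xA.
  by move=> eta _ [/xA].
by move=> eta acc; apply: contrapT => npr; exact: (xA eta).
Qed.

(** Larger radii mean more accepted competitors, hence fewer applicants to [xi] and more levels that
    respect the appetite. *)
Lemma rejection_radius_homo r s : (forall xi, r xi <= s xi)%E ->
  forall xi, (rejection_radius r xi <= rejection_radius s xi)%E.
Proof.
move=> rs xi; apply: ereal_sup_le => t /=; apply: le_trans.
have mB : measurable [set x | ((edist x (\val xi))%:E <= t)%E].
  exact: (measurable_accepts (fun=> t)).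
apply: le_measure; rewrite ?inE; try by apply: measurableI => //;
  exact: measurable_applicants.
apply: setSI => x xs eta acc; apply: xs; exact: le_trans acc (rs eta).
Qed.

Lemma rejection_radiusP r xi (T := fun s => applicants r xi `&`
    [set x | ((edist x (\val xi))%:E <= s)%E])
    (s := rejection_radius r xi) :
  (volume (T s) <= alpha)%E /\ ((s < +oo)%E -> volume (T s) = alpha).
Proof.
apply: (@saturating_level _ _ _ (@volume R d) _ (edist ^~ (\val xi)) alpha) => //.
- exact: measurable_applicants.
- exact: measurable_edist.
- by move=> x; exact: edist_ge0.
- by move=> t; exact: volume_sphere.
- by move=> t; exact: volume_ball_fin.
Qed.

(** Infinitely many centers may be accepted, but those farther than [xi] lose to [xi], and
    discreteness leaves finitely many others to compare. *)
Lemma accepted_favourite r x xi : accepts r x xi ->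
  exists2 eta, accepts r x eta & applicants r eta x.
Proof.
move=> acc.
have /finite_seqP[s sE] : finite_set
    [set eta : Xi | edist x (\val eta) <= edist x (\val xi)].
  exact: finite_centers_edist.
have xis : xi \in [seq eta <- s | `[< accepts r x eta >]].
  rewrite mem_filter asboolT//=.
  by have : [set` s] xi by rewrite -sE /=.
have [|||eta] := @seq_minimum _ (prefers x) [seq eta <- s | `[< accepts r x eta >]].
- exact: prefers_total.
- exact: prefers_trans.
- by apply: contraTneq xis => ->.
rewrite mem_filter => /andP[/asboolP acc_eta _] eta_min; exists eta => //.
move=> zeta acc_zeta; have [le|lt] := leP (edist x (\val zeta)) (edist x (\val xi)).
  apply: eta_min; rewrite mem_filter asboolT//=.
  by have : [set` s] zeta by rewrite -sE.
apply: (prefers_trans (eta_min _ xis)).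
by rewrite /prefers lt.
Qed.

(** * The allocation given by fixed radii, and its stability *)

Section FixedRadii.
Variable r : Xi -> \bar R.
Hypothesis r_fix : forall xi, rejection_radius r xi = r xi.

Let favourite x xi := applicants r xi x /\ accepts r x xi.

Let favourite_inj x xi eta : favourite x xi -> favourite x eta -> xi = eta.
Proof.
move=> [xiP acc_xi] [etaP acc_eta]; apply: (@prefers_anti x).
by rewrite xiP// etaP.
Qed.

Definition radii_allocation x : alloc_value Xi :=
  if pselect (exists xi, favourite x xi) is left ex
  then Center (projT1 (cid ex)) else Infinity.

Lemma radii_allocation_Center x xi :
  radii_allocation x = Center xi <-> favourite x xi.
Proof.
rewrite /radii_allocation; case: pselect => [ex|nex]; last first.
  by split=> // fav; case: nex; exists xi.
case: cid => eta fav_eta /=; split=> [[<-]//|fav_xi].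
by rewrite (favourite_inj fav_xi fav_eta).
Qed.

Lemma radii_allocation_Infinity x :
  radii_allocation x = Infinity <-> forall xi, ~ favourite x xi.
Proof.
rewrite /radii_allocation; case: pselect => [ex|nex]; split=> //.
  by case: ex => xi fav /(_ xi).
by move=> _ xi fav; apply: nex; exists xi.
Qed.

Lemma radii_allocation_Delta x : radii_allocation x <> Delta.
Proof. by rewrite /radii_allocation; case: pselect. Qed.

Lemma territory_radii_allocation xi :
  territory radii_allocation xi = [set x | favourite x xi].
Proof. by apply/seteqP; split=> x /radii_allocation_Center. Qed.

Lemma measurable_radii_allocation : measurable_fun setT radii_allocation.
Proof.
have mfav xi : measurable [set x | favourite x xi].
  rewrite (_ : [set _ | _] = applicants r xi `&` [set x | accepts r x xi])//.
  by apply: measurableI; [exact: measurable_applicants|exact: measurable_accepts].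
move=> _ Y _; rewrite setTI.
(* [Y] is an arbitrary set of values, so its preimage is split into countably many territories and
   possibly the unclaimed set; membership in [Y] enters as a constant set, either full or empty. *)
rewrite (_ : _ @^-1` _ =
  (\bigcup_xi ([set x | favourite x xi] `&` [set _ | Y (Center xi)])) `|`
  (~` (\bigcup_xi [set x | favourite x xi]) `&` [set _ | Y Infinity])).
  have mcst (P : Prop) : measurable [set _ : d.-tuple R | P].
    have [p|np] := pselect P.
      by rewrite (_ : [set _ | _] = setT)//; apply/seteqP; split.
    by rewrite (_ : [set _ | _] = set0)//; apply/seteqP; split.
  apply: measurableU.
    by apply: countable_bigcupT_measurable => // xi; exact: measurableI.
  apply: measurableI => //; apply: measurableC.
  exact: countable_bigcupT_measurable.
apply/seteqP; split=> x /=.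
  case E : (radii_allocation x) => [xi||] Yx.
  - by left; exists xi => //; split=> //; apply/radii_allocation_Center.
  - right; split=> // -[xi _]; exact: (radii_allocation_Infinity x).1.
  - by have := radii_allocation_Delta E.
move=> [[xi _ [/radii_allocation_Center -> //]]|[nfav Yx]].
rewrite (radii_allocation_Infinity x).2// => xi fav.
by apply: nfav; exists xi.
Qed.

Lemma radii_allocation_stable : stable_allocation alpha radii_allocation.
Proof.
(* At a fixed point the applicants to [xi] within its rejection radius are exactly its territory. *)
have volT xi : (volume (territory radii_allocation xi) <= alpha)%E /\
    ((r xi < +oo)%E -> volume (territory radii_allocation xi) = alpha).
  rewrite territory_radii_allocation.
  by have := rejection_radiusP r xi; rewrite r_fix.
split.
  split; first exact: measurable_radii_allocation.
    rewrite (_ : _ @^-1` _ = set0) ?measure0//.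
    by apply/seteqP; split=> // x /radii_allocation_Delta.
  by move=> xi; have [] := volT xi.
move=> x xi [_ _ des cov].
(* If [x] accepted [xi], it would be claimed, and its owner would be no farther than [xi]; either
   way [x] would not desire [xi]. *)
have /negP : ~ accepts r x xi.
  move=> acc; case: des => [[eta /radii_allocation_Center[etaP _]]|].
    by move=> lt; have := prefers_edist (etaP _ acc); rewrite leNgt lt.
  move=> /radii_allocation_Infinity nfav.
  by have [eta ? ?] := accepted_favourite acc; apply: (nfav eta).
rewrite -ltNge => r_lt.
(* The radius of [xi] lies below the real distance from [x], so it is not [+oo]. *)
have sat : sated alpha radii_allocation xi.
  by apply: (volT xi).2; exact: lt_trans r_lt (ltry _).
case: cov => // -[x']; rewrite territory_radii_allocation => -[_ acc'].
have := le_lt_trans acc' r_lt; rewrite lte_fin => lt lt'.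
by have := lt_trans lt lt'; rewrite ltxx.
Qed.

End FixedRadii.

End RadiiFixpoint.

Theorem theorem1 (R : realType) (d : nat) (hd : (1 <= d)%N)
    (Xi : set (d.-tuple R)) (hXi : discrete_centers Xi)
    (alpha : \bar R) (halpha : (0 <= alpha)%E) :
  exists psi : d.-tuple R -> alloc_value Xi, stable_allocation alpha psi.
Proof.
have /countable_injP[f f_inj] := discrete_centers_countable hXi.
(* Any injective numbering of the countably many centers can break ties. *)
pose idx (xi : Xi) := f (\val xi).
have idx_inj : injective idx.
  move=> xi eta /f_inj; rewrite !inE.
  by move=> /(_ (set_valP xi) (set_valP eta)); exact: val_inj.
have [r r_fix] := ereal_fun_fixpoint (@rejection_radius_homo _ _ _ alpha hXi idx).
exists (radii_allocation idx r).
exact: radii_allocation_stable.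
Qed.
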